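(* Let $\hat\omega$ be a state on $\mathcal{O}_d$, $d\ge 2$, with cyclic (GNS) representation $(\mathcal{H},\Omega,\pi)$; put $S_i=\pi(s_i)$, let $\mathcal{K}\subset\mathcal{H}$ be the closed linear span of all vectors $S_I^*\Omega$, $I\in\mathcal{I}$, let $P$ be the orthogonal projection of $\mathcal{H}$ onto $\mathcal{K}$, let $V_i\in\mathcal{B}(\mathcal{K})$ be given by $V_i^*=PS_i^*P=S_i^*P$ (restricted to $\mathcal{K}$), and let $\boldsymbol{\sigma}\colon\mathcal{B}(\mathcal{K})\to\mathcal{B}(\mathcal{K})$ be the completely positive unital map $\boldsymbol{\sigma}(A)=\sum_{i=1}^dV_iAV_i^*$. Then the selfadjoint part of the commutant $\pi(\mathcal{O}_d)'$ is norm and order isomorphic to the space of selfadjoint fixed points of $\boldsymbol{\sigma}$. This isomorphism takes $A\in\pi(\mathcal{O}_d)'$ into $PAP\in\mathcal{B}(\mathcal{K})^{\boldsymbol{\sigma}}$.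
   Context: $\mathcal{O}_d$ is the universal $C^*$-algebra generated by $s_1,\dots,s_d$ with $s_i^*s_j=\delta_{ij}1$ and $\sum_{j}s_js_j^*=1$. $\mathcal{I}$ is the set of finite sequences $I=(i_1,\dots,i_m)$ with entries in $\{1,\dots,d\}$, including the empty sequence; $S_I=S_{i_1}\cdots S_{i_m}$, $S_I^*=S_{i_m}^*\cdots S_{i_1}^*$, and $S_\varnothing=1$. $\mathcal{B}(\mathcal{K})^{\boldsymbol{\sigma}}=\{A\in\mathcal{B}(\mathcal{K}):\boldsymbol{\sigma}(A)=A\}$. Operators of the form $PAP$ are regarded as operators on $\mathcal{K}=P\mathcal{H}$. ''Norm and order isomorphic'' means there is a real-linear bijection which is isometric and preserves positivity in both directions. *)

(* Defs.v *)
From HB Require Import structures.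
From mathcomp Require Import all_boot all_order all_algebra.
From mathcomp Require Import complex.
From mathcomp Require Import all_classical all_reals all_analysis.

Set Implicit Arguments.
Unset Strict Implicit.
Unset Printing Implicit Defensive.

Import Order.TTheory GRing.Theory Num.Theory.
Import numFieldNormedType.Exports.

Local Open Scope classical_set_scope.
Local Open Scope ring_scope.
Local Open Scope complex_scope.

(* The norm of a normed module over R[i] takes its values in R[i].  The inner
   product is linear in its first argument and antilinear in the second. *)
HB.mixin Record NormedModule_isHilbert (R : realType) (H : Type)
    & CompleteNormedModule R[i] H := {
  inner : {dot H for @Num.conj R[i]} ;
  inner_norm : forall x : H, inner x x = `|x| ^+ 2
}.

#[short(type="hilbertType")]
HB.structure Definition Hilbert (R : realType) :=
  {H of CompleteNormedModule R[i] H & NormedModule_isHilbert R H}.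

Notation "''[' x , y ]" := (inner x y)
  (at level 0, format "''[' x ,  y ]") : ring_scope.

(* Unital C*-algebras.  The product is a field of the structure because the
   library has no common extension of its rings and its normed modules. *)
HB.mixin Record NormedModule_isCstar (R : realType) (A : Type)
    & CompleteNormedModule R[i] A := {
  cmul : A -> A -> A ;
  cone : A ;
  star : A -> A ;
  cmulA : associative cmul ;
  cmul1l : left_id cone cmul ;
  cmul1r : right_id cone cmul ;
  cmul_linearl : forall y : A, linear (cmul ^~ y) ;
  cmul_linearr : forall x : A, linear (cmul x) ;
  starK : involutive star ;
  starD : {morph star : x y / x + y} ;
  starZ : forall (a : R[i]) (x : A), star (a *: x) = a^* *: star x ;
  starM : forall x y : A, star (cmul x y) = cmul (star y) (star x) ;
  cmul_norm : forall x y : A, `|cmul x y| <= `|x| * `|y| ;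
  cstar_norm : forall x : A, `|cmul (star x) x| = `|x| ^+ 2
}.

#[short(type="cstarType")]
HB.structure Definition Cstar (R : realType) :=
  {A of CompleteNormedModule R[i] A & NormedModule_isCstar R A}.

Section ClosedSubspace.
Variables (R : realType) (H : hilbertType R).

Record closedSubspace := ClosedSubspace {
  cs_set :> set H ;
  cs0 : cs_set 0 ;
  csP : forall (a : R[i]) (x y : H),
    cs_set x -> cs_set y -> cs_set (a *: x + y) ;
  cs_closed : closed cs_set
}.

Record subhilbert (M : closedSubspace) :=
  Subhilbert { subhilbert_val : H ; _ : subhilbert_val \in cs_set M }.

Variable M : closedSubspace.

HB.instance Definition _ := [isSub for @subhilbert_val M].
HB.instance Definition _ := [Choice of subhilbert M by <:].

Lemma subhilbert_submod : GRing.submod_closed (mem (cs_set M)).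
Proof.
split; first by rewrite mem_set//; exact: cs0.
by move=> a x y /set_mem Mx /set_mem My; apply/mem_set; exact: csP.
Qed.

HB.instance Definition _ :=
  GRing.SubChoice_isSubLmodule.Build R[i] H _ (subhilbert M) subhilbert_submod.

Let subhilbert_norm (x : subhilbert M) : R[i] := `|val x|.

Let subhilbert_normD x y :
  subhilbert_norm (x + y) <= subhilbert_norm x + subhilbert_norm y.
Proof. exact: ler_normD. Qed.

Let subhilbert_normZ (l : R[i]) x :
  subhilbert_norm (l *: x) = `|l| * subhilbert_norm x.
Proof. exact: normrZ. Qed.

Let subhilbert_norm_eq0 x : subhilbert_norm x = 0 -> x = 0.
Proof. by move=> /normr0_eq0 x0; apply/val_inj; rewrite x0 raddf0. Qed.

HB.instance Definition _ := Lmodule_isNormed.Build R[i] (subhilbert M)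
  subhilbert_normD subhilbert_normZ subhilbert_norm_eq0.

Let subhilbert_normB (x y : subhilbert M) : `|x - y| = `|val x - val y|.
Proof.
rewrite -[LHS]/(`|val (x - y)|); congr (`|_|); exact: (@raddfB (subhilbert M) H).
Qed.

Let subhilbert_complete (F : set_system (subhilbert M)) :
  ProperFilter F -> cauchy F -> cvg F.
Proof.
move=> FF /cauchy_ballP Fc.
have vc : cauchy (val @ F : set_system H).
  apply/cauchy_ballP => e e0.
  rewrite near_map2; apply: filterS (Fc e e0) => -[x y] /=.
  by rewrite -!ball_normE /= subhilbert_normB.
have vl := @cauchy_cvg _ _ (fmap_proper_filter _ FF) vc; set l := lim _ in vl.
have Ml : cs_set M l.
  have MF : \forall x \near F, cs_set M (val x).
    by apply: nearW => x; exact/set_mem/(valP x).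
  exact: (closed_cvg (cs_set M) (@cs_closed M) MF l vl).
apply/cvg_ex; exists (Subhilbert (mem_set Ml)).
apply/cvgrPdist_lt => e e0; near=> x.
have : `|l - val x| < e by near: x; move/cvgrPdist_lt : vl => /(_ e e0).
by rewrite subhilbert_normB.
Unshelve. all: by end_near. Qed.

HB.instance Definition _ :=
  Uniform_isComplete.Build (subhilbert M) subhilbert_complete.

Definition subhilbert_inner (x y : subhilbert M) : R[i] := '[val x, val y].

Let subhilbert_inner_bilinear :
  bilinear_for (GRing.Scale.Law.clone _ _ *%R _)
    (GRing.Scale.Law.clone _ _ (@Num.conj R[i] \; *%R) _) subhilbert_inner.
Proof.
have valP a x y : val (a *: x + y) = a *: val x + val y :> H by exact: linearP.
split=> [u'|u] a x y /=; rewrite /subhilbert_inner valP.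
- by rewrite linearPl.
- by rewrite linearPr.
Qed.

HB.instance Definition _ :=
  bilinear_isBilinear.Build R[i] (subhilbert M) (subhilbert M) R[i] _ _ subhilbert_inner
  subhilbert_inner_bilinear.

Let subhilbert_inner_herm (x y : subhilbert M) :
  subhilbert_inner x y = (-1) ^+ false * Num.conj (subhilbert_inner y x).
Proof. exact: hermitian_subproof. Qed.

HB.instance Definition _ :=
  isHermitianSesquilinear.Build _ _ _ _ subhilbert_inner subhilbert_inner_herm.

Let subhilbert_inner_gt0 (x : subhilbert M) : x != 0 -> 0 < subhilbert_inner x x.
Proof.
move=> x0; apply: neq0_dnorm_gt0; apply: contra_neq x0 => x0.
by apply/val_inj; rewrite x0 raddf0.
Qed.

HB.instance Definition _ :=
  isDotProduct.Build _ _ subhilbert_inner subhilbert_inner_gt0.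

Let subhilbert_inner_norm (x : subhilbert M) : subhilbert_inner x x = `|x| ^+ 2.
Proof. exact: inner_norm. Qed.

HB.instance Definition _ :=
  NormedModule_isHilbert.Build R (subhilbert M) subhilbert_inner_norm.

End ClosedSubspace.

Section ClosedSpan.
Variables (R : realType) (H : hilbertType R) (X : set H).

Definition lspan : set H :=
  [set x | exists n (a : 'I_n -> R[i]) (v : 'I_n -> H),
    (forall k, X (v k)) /\ x = \sum_(k < n) a k *: v k].

Let lspan0 : lspan 0.
Proof.
by exists 0%N, (fun=> 0), (fun=> 0); split=> [[]//|]; rewrite big_ord0.
Qed.

Let lspanP (a : R[i]) x y : lspan x -> lspan y -> lspan (a *: x + y).
Proof.
move=> [m [b [u [Xu ->]]]] [n [c [v [Xv ->]]]].
exists (m + n)%N.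
exists (fun k => match fintype.split k with inl i => a * b i | inr j => c j end).
exists (fun k => match fintype.split k with inl i => u i | inr j => v j end).
split=> [k|]; first by case: fintype.split.
rewrite big_split_ord/= scaler_sumr; congr (_ + _).
  by apply: eq_bigr => i _; rewrite (unsplitK (inl i)) scalerA.
by apply: eq_bigr => i _; rewrite (unsplitK (inr i)).
Qed.

Let closure0 : closure lspan 0.
Proof. exact/subset_closure/lspan0. Qed.

Let closureP (a : R[i]) x y :
  closure lspan x -> closure lspan y -> closure lspan (a *: x + y).
Proof.
move=> Cx Cy B Bxy.
have cf : (fun z : H * H => a *: z.1 + z.2) @ (x, y) --> a *: x + y.
  by apply: cvgD; [apply: cvgZl_tmp; exact: cvg_fst|exact: cvg_snd].
have [[U V]/= [Ux Vy] UV] := cf _ Bxy.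
have [x' [Sx' Ux']] := Cx _ Ux; have [y' [Sy' Vy']] := Cy _ Vy.
by exists (a *: x' + y'); split; [exact: lspanP|exact: (UV (x', y'))].
Qed.

Definition closed_span : closedSubspace H :=
  ClosedSubspace closure0 closureP (@closed_closure _ lspan).

End ClosedSpan.

Section Operators.
Variables (R : realType) (H : hilbertType R).
Implicit Types A B : H -> H.

Definition bounded_op : set (H -> H) := [set A | linear A /\ continuous A].

Definition is_adjoint A B := forall x y, '[A x, y] = '[x, B y].

(* Every bounded operator has exactly one adjoint, so the default value is
   irrelevant on [bounded_op]. *)
Definition adj A : H -> H := xget (fun=> 0) [set B | is_adjoint A B].

Definition selfadjoint : set (H -> H) := [set A | adj A = A].

Definition op_ge0 : set (H -> H) := [set A | forall x, 0 <= '[A x, x]].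

Definition opnorm A : R :=
  sup [set complex.Re `|A x| | x in [set x | `|x| <= 1]].

Definition commutant (X : set (H -> H)) : set (H -> H) :=
  [set A | bounded_op A /\ forall T, X T -> A \o T = T \o A].

(* [word_op T [:: i_1; ...; i_m]] is the product T_{i_1} ... T_{i_m}. *)
Definition word_op (I : Type) (T : I -> H -> H) (w : seq I) : H -> H :=
  foldr (fun i B => T i \o B) idfun w.

Definition word_adj (I : Type) (T : I -> H -> H) (w : seq I) : H -> H :=
  word_op (fun i => adj (T i)) (rev w).

Definition kraus_map (d : nat) (V : 'I_d -> H -> H) A : H -> H :=
  \sum_(i < d) (V i \o A \o adj (V i)).

Definition fixed_points (F : (H -> H) -> H -> H) : set (H -> H) :=
  [set A | bounded_op A /\ F A = A].

End Operators.

Arguments bounded_op {R} H.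
Arguments selfadjoint {R} H.

Section Compression.
Variables (R : realType) (H : hilbertType R) (M : closedSubspace H).

(* The orthogonal projection onto M, with values in M; the projection theorem
   makes the default value irrelevant. *)
Definition proj (x : H) : subhilbert M :=
  xget 0 [set p | forall y : subhilbert M, '[x - val p, val y] = 0].

(* P A P as an operator on M = P H. *)
Definition compress (A : H -> H) : subhilbert M -> subhilbert M :=
  fun x => proj (A (val x)).

End Compression.

Arguments compress {R H} M A.

Definition norm_order_iso (R : realType) (H K : hilbertType R)
    (X : set (H -> H)) (Y : set (K -> K)) (Phi : (H -> H) -> K -> K) :=
  [/\ set_bij X Y Phi,
      forall (r : R) A B, X A -> X B ->
        Phi (r%:C *: A + B) = r%:C *: Phi A + Phi B,
      forall A, X A -> opnorm (Phi A) = opnorm A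
    & forall A, X A -> op_ge0 (Phi A) <-> op_ge0 A].

Section Cstar.
Variable R : realType.

Definition star_hom (A B : cstarType R) (phi : A -> B) :=
  [/\ linear phi, phi cone = cone,
      forall x y, phi (cmul x y) = cmul (phi x) (phi y)
    & forall x, phi (star x) = star (phi x)].

Definition closed_star_subalgebra (A : cstarType R) (B : set A) :=
  [/\ B cone,
      forall (a : R[i]) x y, B x -> B y -> B (a *: x + y),
      forall x y, B x -> B y -> B (cmul x y),
      forall x, B x -> B (star x)
    & closed B].

Definition cuntz_relations (d : nat) (A : cstarType R) (s : 'I_d -> A) :=
  (forall i j, cmul (star (s i)) (s j) = if i == j then cone else 0) /\
  \sum_(j < d) cmul (s j) (star (s j)) = cone.

(* A is the universal C*-algebra O_d with generators s: it is generated by s,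
   and s maps onto any other solution of the relations. *)
Definition cuntz_algebra (d : nat) (A : cstarType R) (s : 'I_d -> A) :=
  [/\ cuntz_relations s,
      forall B : set A,
        closed_star_subalgebra B -> (forall i, B (s i)) -> B = setT
    & forall (B : cstarType R) (t : 'I_d -> B), cuntz_relations t ->
        exists phi : A -> B, star_hom phi /\ forall i, phi (s i) = t i].

Definition state (A : cstarType R) (omega : A -> R[i]) :=
  [/\ scalar omega, forall x, 0 <= omega (cmul (star x) x) & omega cone = 1].

Definition representation (A : cstarType R) (H : hilbertType R)
    (pi : A -> H -> H) :=
  [/\ forall x, bounded_op H (pi x), linear pi, pi cone = idfun,
      forall x y, pi (cmul x y) = pi x \o pi y
    & forall x, is_adjoint (pi x) (pi (star x))].

Definition gns_representation (A : cstarType R) (omega : A -> R[i])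
    (H : hilbertType R) (Omega : H) (pi : A -> H -> H) :=
  [/\ representation pi, closure (range (fun x => pi x Omega)) = setT
    & forall x, omega x = '[pi x Omega, Omega]].

End Cstar.

(* Main.v *)
(* Write T_i = S_i^*, let K_0 = K and K_{n+1} = {x | T_i x in K_n for all i}.
   The K_n increase because K is T_i-invariant, and their union is dense: its
   closure contains Omega and is invariant under S_i and T_i, hence under the
   whole representation.  This uses the continuity of x |-> pi x h, which
   comes from the positivity of 1 - x for selfadjoint x of norm at most 1/2.
   Since sum_i S_i T_i = 1, an A in the commutant satisfies
   <A x, y> = sum_i <A T_i x, T_i y>, so positivity and norm bounds propagate
   from PAP to every K_n and by density to H.  Conversely, for a fixed point B
   the operators A_0 = BP, A_{n+1} = sum_i S_i A_n T_i are uniformly bounded,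
   and <A_{n+1} x, y> = <A_n x, y> on K_n.  Hence |A_n x| is eventually
   nondecreasing for x in the union, A_n converges strongly, and its limit
   commutes with all S_i and T_i and compresses to B. *)

From HB Require Import structures.
Require Import Defs.
From mathcomp Require Import all_boot all_order all_algebra.
From mathcomp Require Import complex.
From mathcomp Require Import all_classical all_reals all_analysis.
From mathcomp Require Import ring.

Set Implicit Arguments.
Unset Strict Implicit.
Unset Printing Implicit Defensive.

Import Order.TTheory GRing.Theory Num.Theory.
Import numFieldNormedType.Exports.

Local Open Scope classical_set_scope.
Local Open Scope ring_scope.
Local Open Scope complex_scope.

(** * Inner-product calculus and the Cauchy-Schwarz inequality *)

Section InnerProduct.
Variables (R : realType) (H : hilbertType R).
Local Notation C := R[i].
Implicit Types (x y z : H) (a : C).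

Lemma innerC x y : '[x, y] = ('[y, x])^*%R.
Proof. by rewrite (hermC (@inner R H)) expr0 mul1r. Qed.

Lemma innerDl x y z : '[x + y, z] = '[x, z] + '[y, z].
Proof. exact: linearDl. Qed.

Lemma innerDr x y z : '[x, y + z] = '[x, y] + '[x, z].
Proof. exact: linearDr. Qed.

Lemma innerBl x y z : '[x - y, z] = '[x, z] - '[y, z].
Proof. exact: linearBl. Qed.

Lemma innerBr x y z : '[x, y - z] = '[x, y] - '[x, z].
Proof. exact: linearBr. Qed.

Lemma innerZl a x y : '[a *: x, y] = a * '[x, y].
Proof. exact: linearZl_LR. Qed.

Lemma innerZr a x y : '[x, a *: y] = a^*%R * '[x, y].
Proof. exact: linearZr_LR. Qed.

Lemma inner0l x : '[0, x] = 0.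
Proof. exact: linear0l. Qed.

Lemma inner0r x : '[x, 0] = 0.
Proof. exact: linear0r. Qed.

Lemma inner_suml I (r : seq I) (F : I -> H) y :
  '[\sum_(i <- r) F i, y] = \sum_(i <- r) '[F i, y].
Proof. by rewrite linear_sumlz. Qed.

Lemma inner_ge0 x : 0 <= '[x, x].
Proof. by rewrite inner_norm exprn_ge0. Qed.

Lemma inner_eq0 x : '[x, x] = 0 -> x = 0.
Proof. by rewrite inner_norm => /eqP; rewrite expf_eq0/= normr_eq0 => /eqP. Qed.

Lemma inner_ext x y : (forall z, '[x, z] = '[y, z]) -> x = y.
Proof.
by move=> xy; apply/subr0_eq/inner_eq0; rewrite innerBl xy subrr.
Qed.

Lemma inner_extr x y : (forall z, '[z, x] = '[z, y]) -> x = y.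
Proof. by move=> xy; apply: inner_ext => z; rewrite innerC xy -innerC. Qed.

Lemma inner_cauchy_schwarz x y : `|'[x, y]| <= `|x| * `|y|.
Proof.
have [->|y0] := eqVneq y 0; first by rewrite inner0r !normr0 mulr0.
have yy0 : 0 < '[y, y] by rewrite inner_norm exprn_gt0 ?normr_gt0.
rewrite -ler_sqr ?nnegrE ?mulr_ge0// exprMn -!inner_norm.
(* [a *: y] is the orthogonal projection of [x] onto the line of [y]; the inequality is the
   nonnegativity of the squared length of the remainder. *)
set a := '[x, y] / '[y, y].
have uy : '[x - a *: y, y] = 0.
  by rewrite innerBl innerZl divfK ?subrr// gt_eqF.
have := inner_ge0 (x - a *: y).
rewrite innerBr innerZr uy mulr0 subr0 innerBl innerZl subr_ge0.
by rewrite mulrAC ler_pdivrMr// (innerC y x) -normCK.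
Qed.

(** Solved for the difference because [riesz] compares two near-minimizers with their midpoint. *)
Lemma parallelogram x y :
  '[x - y, x - y] = '[x, x] *+ 2 + '[y, y] *+ 2 - '[x + y, x + y].
Proof. by rewrite !(innerBl, innerBr, innerDl, innerDr); ring. Qed.

End InnerProduct.

(** * Continuity, closed conditions and bounded operators *)

Section Continuity.
Variable R : realType.
Local Notation C := R[i].

Lemma lipschitz_cts (V W : normedModType C) (c : C) (f : V -> W) :
  (forall x y, `|f x - f y| <= c * `|x - y|) -> continuous f.
Proof.
move=> fc x; apply/cvgrPdist_lt => e e0; near=> y.
(* The constant [c] is an arbitrary complex number; [|c| + 1] is positive, so one can divide by
   it. *)
have c0 : 0 <= `|c| + 1 by rewrite addr_ge0.
have c1 : 0 < `|c| + 1 by rewrite ltr_wpDl.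
have h : `|x - y| < e / (`|c| + 1).
  by near: y; apply: cvgr_dist_lt => //; rewrite divr_gt0.
apply: le_lt_trans (fc _ _) _.
have /ger0_norm <- : 0 <= c * `|x - y| by apply: le_trans (fc _ _).
rewrite normrM normr_id (@le_lt_trans _ _ ((`|c| + 1) * `|x - y|))//.
  by rewrite ler_wpM2r// lerDl.
by rewrite mulrC -ltr_pdivlMr.
Unshelve. all: by end_near. Qed.

(** In the partial order of [C], being nonnegative means [|z| = z], which is the vanishing of a
    Lipschitz function. *)
Lemma closed_ge0 : closed ([set z | 0 <= z] : set C^o).
Proof.
have -> : ([set z | 0 <= z] : set C^o) =
    (fun z : C^o => `|z| - z : C^o) @^-1` [set 0].
  apply/seteqP; split=> z/=; first by move=> /ger0_norm ->; rewrite subrr.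
  by move=> /subr0_eq <-.
apply: (@closed_comp C^o C^o).
- move=> z _; apply: (@lipschitz_cts C^o C^o 2) => {}z w /=.
  have -> : `|z| - z - (`|w| - w) = (`|z| - `|w|) + (w - z) by ring.
  apply: le_trans (ler_normD _ _) _; rewrite mulr_natl mulr2n.
  by rewrite lerD ?ler_dist_dist// distrC.
- apply: accessible_closed_set1; apply: hausdorff_accessible.
  exact: (@norm_hausdorff _ C^o).
Qed.

Lemma closed_ler (V : normedModType C) (f g : V -> C^o) :
  continuous f -> continuous g -> closed [set x | f x <= g x].
Proof.
move=> fc gc; have -> : [set x | f x <= g x] =
    (fun x => g x - f x : C^o) @^-1` [set z | 0 <= z].
  by apply/seteqP; split=> x /=; rewrite subr_ge0.
apply: closed_comp closed_ge0 => x _; exact: continuousB (gc x) (fc x).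
Qed.

Lemma closed_eq (V W : normedModType C) (f g : V -> W) :
  continuous f -> continuous g -> closed [set x | f x = g x].
Proof.
move=> fc gc.
have -> : [set x | f x = g x] = (fun x => g x - f x) @^-1` [set 0].
  by apply/seteqP; split=> x /=; [move=> ->; rewrite subrr|move/subr0_eq].
apply: closed_comp => [x _|]; first exact: continuousB (gc x) (fc x).
apply: accessible_closed_set1; apply: hausdorff_accessible.
exact: norm_hausdorff.
Qed.

Variable H : hilbertType R.

Lemma inner_ctsl (y : H) : continuous (fun x => '[x, y] : C^o).
Proof.
apply: (@lipschitz_cts H C^o `|y|) => x z.
by rewrite -innerBl mulrC inner_cauchy_schwarz.
Qed.

Lemma inner_ctsr (y : H) : continuous (fun x => '[y, x] : C^o).
Proof.
apply: (@lipschitz_cts H C^o `|y|) => x z.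
by rewrite -innerBr inner_cauchy_schwarz.
Qed.

Lemma inner_cvg U (F : set_system U) (FF : Filter F) (f g : U -> H) (a b : H) :
  f @ F --> a -> g @ F --> b -> (fun t => '[f t, g t] : C^o) @ F --> ('[a, b] : C^o).
Proof.
move=> fa gb.
apply/cvgrPdist_lt => e e0.
have e3 : 0 < e / 3%:R by rewrite divr_gt0.
have e4 (z : H) : 0 < e / 3%:R / (`|z| + 1) by apply: divr_gt0 => //; apply: ltr_wpDl.
have le_div (p q : C) : 0 <= p -> 0 <= q -> p < e / 3%:R / (q + 1) -> p * q <= e / 3%:R.
  move=> p0 q0; rewrite ltr_pdivlMr ?ltr_wpDl// => /ltW; apply: le_trans.
  by rewrite mulrDr mulr1 lerDl.
near=> t.
(* Expanded around the limits, two terms pair an error with a fixed vector. In the third, one error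
   is taken below [e / 3] and the other below 1. *)
have -> : '[a, b] - '[f t, g t] =
    '[a - f t, b] + '[a, b - g t] - '[a - f t, b - g t].
  by rewrite !(innerBl, innerBr); ring.
have -> : e = e / 3%:R + e / 3%:R + e / 3%:R by field.
apply: le_lt_trans (ler_normB _ _) _.
apply: ler_ltD; first (apply: le_trans (ler_normD _ _) _; apply: lerD).
- apply: le_trans (inner_cauchy_schwarz _ _) (le_div _ _ (normr_ge0 _) (normr_ge0 _) _).
  near: t; move/cvgrPdist_lt : fa; apply; exact: e4.
- apply: le_trans (inner_cauchy_schwarz _ _) _; rewrite mulrC.
  apply: (le_div _ _ (normr_ge0 _) (normr_ge0 _)).
  near: t; move/cvgrPdist_lt : gb; apply; exact: e4.
- apply: le_lt_trans (inner_cauchy_schwarz _ _) _; rewrite -[ltRHS]mulr1.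
  apply: ltr_pM => //; near: t; first by move/cvgrPdist_lt : fa; apply.
  by move/cvgrPdist_lt : gb; apply.
Unshelve. all: by end_near. Qed.

Lemma bounded_opP (A : H -> H) :
  bounded_op H A <-> linear A /\ exists2 c : R, 0 <= c & forall x, `|A x| <= c%:C * `|x|.
Proof.
split=> [[lA cA]|[lA [c c0 Ac]]]; last first.
  split=> //; apply: lipschitz_cts => x y.
  pose f : {linear H -> H} := HB.pack A (GRing.isLinear.Build _ _ _ _ A lA).
  rewrite -[A]/(f : H -> H) -linearB; exact: Ac.
split=> //.
pose f : {linear H -> H} := HB.pack A (GRing.isLinear.Build _ _ _ _ A lA).
have /linear_boundedP/pinfty_ex_gt0[M M0 MA] : bounded_near f (nbhs (0 : H)).
  exact/linear_bounded_continuous.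
exists (complex.Re M); first by move: M0; rewrite ltcE => /andP[_ /ltW].
by move=> x; rewrite RRe_real; [exact: MA|exact: gtr0_real].
Qed.

End Continuity.

(** * Linearity rules for bare functions *)

Section RawLinear.
Variables (C : nzRingType) (U V : lmodType C) (A : U -> V).
Hypothesis lA : linear A.

Let f : {linear U -> V} := HB.pack A (GRing.isLinear.Build _ _ _ _ A lA).

Lemma lin0 : A 0 = 0. Proof. exact: (linear0 f). Qed.
Lemma linB x y : A (x - y) = A x - A y. Proof. exact: (linearB f). Qed.
Lemma linZ a x : A (a *: x) = a *: A x. Proof. exact: (linearZ_LR f). Qed.
Lemma lin_sum I (r : seq I) (F : I -> U) :
  A (\sum_(i <- r) F i) = \sum_(i <- r) A (F i).
Proof. exact: (linear_sum f). Qed.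

End RawLinear.

(** * Cauchy sequences and the Archimedean property *)

Section Sequences.
Variables (R : realType) (V : completeNormedModType R[i]).
Local Notation C := R[i].

Lemma cauchy_seq_cvg (u : nat -> V) :
  (forall e : C, 0 < e -> exists N, forall m n, (N <= m)%N -> (N <= n)%N ->
    `|u m - u n| < e) ->
  exists l : V, u @ \oo --> l.
Proof.
move=> cu; suff ucvg : cauchy (u @ \oo).
  by exists (lim (u @ \oo)); exact: cauchy_cvg ucvg.
apply/cauchy_ballP => e e0.
have [N uN] := cu e e0.
rewrite near_map2; exists ([set n : nat | (N <= n)%N], [set n : nat | (N <= n)%N]).
  by split; exists N.
by move=> [m n] [/= Nm Nn]; rewrite -ball_normE/=; exact: uN.
Qed.

(** Positive elements of [C] are real, so the Archimedean property of [R] carries over. *)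
Lemma ltr_inv_nat (e : C) : 0 < e ->
  exists N, forall n, (N <= n)%N -> n.+1%:R^-1 < e.
Proof.
move=> e0; have re : (complex.Re e)%:C = e by rewrite RRe_real// gtr0_real.
have e'0 : 0 < complex.Re e by move: e0; rewrite -re ltcR.
have [N _ hN] := near_infty_natSinv_lt (PosNum e'0).
exists N => n /hN /=; rewrite -ltcR re; apply: le_lt_trans.
by rewrite fmorphV/= rmorph_nat.
Qed.

End Sequences.

(** * Riesz representation of bounded functionals *)

Section Riesz.
Variables (R : realType) (H : hilbertType R).
Local Notation C := R[i].

(* The representing vector minimizes |y|^2 - 2 Re (f y). *)
Theorem riesz (f : H -> C) (c : R) :
  scalar f -> (forall x, `|f x| <= c%:C * `|x|) ->
  exists y, forall x, f x = '[x, y].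
Proof.
move=> lf fc.
have fD x y : f (x + y) = f x + f y.
  by rewrite -[X in f (X + _)]scale1r lf mul1r.
have f0 : f 0 = 0 by apply: (addrI (f 0)); rewrite -fD !addr0.
have fZ a x : f (a *: x) = a * f x by rewrite -[_ *: _]addr0 lf f0 addr0.
(* Adding the conjugate gives twice the real part of [f y]; the infimum is then taken over the real
   parts of the real-valued [j]. *)
pose j y := '[y, y] - (f y + (f y)^*%R).
have jR y : (complex.Re (j y))%:C = j y.
  apply/RRe_real; apply: rpredB; first by rewrite ger0_real ?inner_ge0.
  by apply/CrealP; rewrite rmorphD/= conjCK addrC.
have j_ge y : - (c ^+ 2)%:C <= j y.
  have le2 : f y + (f y)^*%R <= c%:C * `|y| *+ 2.
    apply: (@le_trans _ _ `|f y + (f y)^*%R|).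
      by apply: real_ler_norm; apply/CrealP; rewrite rmorphD/= conjCK addrC.
    by rewrite (le_trans (ler_normD _ _))// norm_conjC -mulr2n lerMn2r/= fc.
  apply: (@le_trans _ _ ('[y, y] - c%:C * `|y| *+ 2)); last by rewrite lerB.
  rewrite inner_norm -subr_ge0 rmorphXn/=.
  have -> : `|y| ^+ 2 - c%:C * `|y| *+ 2 - - c%:C ^+ 2 = (`|y| - c%:C) ^+ 2.
    by ring.
  rewrite real_exprn_even_ge0// rpredB//; first exact: ger0_real.
  by apply/complex_realP; exists c.
pose J := range (fun y => complex.Re (j y)).
have infJ : has_inf J.
  split; first by exists (complex.Re (j 0)), 0.
  exists (- (c ^+ 2)) => _ [y _ <-].
  by rewrite -lecR jR rmorphN/= j_ge.
set m := inf J.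
have mj y : m%:C <= j y.
  by rewrite -jR lecR ge_inf//; [case: infJ|exists y].
have jm n : exists y, j y <= m%:C + n.+1%:R^-1.
  have [|_ [y _ <-] ym] := @inf_adherent _ J n.+1%:R^-1 _ infJ => //.
  exists y; rewrite -jR ltW// (lt_le_trans (y := (m + n.+1%:R^-1)%:C)) ?ltcR//.
  by rewrite rmorphD fmorphV/= rmorph_nat.
have [u um] := choice jm.
(* By the parallelogram law [|p - n|^2] is [2 j p + 2 j n] minus four times [j] at the midpoint,
   where [j] is at least [m]. *)
have ucauchy p n (d : C) : j p <= m%:C + d -> j n <= m%:C + d -> `|p - n| ^+ 2 <= d *+ 4.
  move=> jp jn; rewrite -inner_norm parallelogram.
  have := mj (2^-1 *: (p + n)).
  rewrite /j fZ fD innerZl innerZr rmorphM rmorphD/= fmorphV/= conjC_nat => h.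
  move: jp jn h; rewrite -subr_ge0 => jp; rewrite -subr_ge0 => jn.
  rewrite -subr_ge0 => /(mulrn_wge0 4) h; rewrite -subr_ge0.
  apply: le_trans (addr_ge0 (mulrn_wge0 2 (addr_ge0 jp jn)) h) _.
  by rewrite le_eqVlt; apply/orP; left; apply/eqP; rewrite /j; field.
(* Quantitative first-order condition: moving [u n] along [v] by the multiple [b^* / q] lowers [j]
   by at least [|b|^2 / q], which cannot exceed the defect of [u n]. An upper bound [q] replaces
   ['[v, v]] so that [v = 0] is covered. *)
have beta n v q : 0 < q -> '[v, v] <= q -> `|'[v, u n] - f v| ^+ 2 <= n.+1%:R^-1 * q.
  move=> q0 vq; move def_b: ('[v, u n] - f v) => b; set d := n.+1%:R^-1.
  have qR : q^*%R = q by apply/CrealP; exact: gtr0_real.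
  set p := `|b| ^+ 2 / q; rewrite -ler_pdivrMr// -/p.
  have bb : b * b^*%R = p * q by rewrite divfK ?gt_eqF// normCK.
  have p0 : 0 <= p by rewrite divr_ge0 ?exprn_ge0// ltW.
  have h : m%:C <= m%:C + d - p *+ 2 + p * ('[v, v] / q).
    apply: le_trans (mj (u n - (b^*%R / q) *: v)) _.
    apply: (@le_trans _ _ (j (u n) - p *+ 2 + p * ('[v, v] / q))); last first.
      by rewrite !lerD2r um.
    rewrite le_eqVlt; apply/orP; left; apply/eqP.
    rewrite /j -scaleNr fD fZ !(innerDl, innerDr, innerZl, innerZr).
    rewrite (innerC (u n) v) !(rmorphD, rmorphN, rmorphM, fmorphV) /= conjCK qR.
    have -> : f v = '[v, u n] - b by rewrite -def_b opprB addrC subrK.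
    rewrite rmorphB/= /p normCK; field.
    by rewrite gt_eqF.
  have {h}: 0 <= d - p *+ 2 + p * ('[v, v] / q).
    by move: h; rewrite -!addrA lerDl.
  move=> h; rewrite -subr_ge0; apply: le_trans h _.
  rewrite -subr_ge0; have -> : d - p - (d - p *+ 2 + p * ('[v, v] / q)) =
    p * (1 - '[v, v] / q) by ring.
  by rewrite mulr_ge0// subr_ge0 ler_pdivrMr// mul1r.
have [l ul] : exists l : H, u @ \oo --> l.
  apply: cauchy_seq_cvg => e e0.
  have e1 : 0 < e ^+ 2 / 4%:R by rewrite divr_gt0// exprn_gt0.
  have [N hN] := ltr_inv_nat e1; exists N => p n Np Nn.
  have e2 k : (N <= k)%N -> j (u k) <= m%:C + N.+1%:R^-1.
    by move=> Nk; rewrite (le_trans (um k))// lerD2l lef_pV2 ?posrE// ler_nat.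
  rewrite -(ltr_pXn2r (n := 2)) ?nnegrE ?(ltW e0)//.
  apply: le_lt_trans (ucauchy _ _ _ (e2 _ Np) (e2 _ Nn)) _.
  by rewrite -(mulr_natr _ 4) -ltr_pdivlMr//; exact: hN.
exists l => v.
apply: (@cvg_unique C^o _ ((fun n => '[v, u n] : C^o) @ \oo)).
- exact: (@norm_hausdorff _ C^o).
- apply/(@cvgrPdist_lt _ C^o) => e e0.
  have q0 : 0 < '[v, v] + 1 by rewrite ltr_wpDl// inner_ge0.
  have e1 : 0 < e ^+ 2 / ('[v, v] + 1) by rewrite divr_gt0// exprn_gt0.
  have [N hN] := ltr_inv_nat e1; exists N => // n /= Nn.
  rewrite -(ltr_pXn2r (n := 2)) ?nnegrE ?(ltW e0)// distrC.
  by apply: le_lt_trans (beta n v _ q0 _) _; rewrite ?lerDl//; rewrite -ltr_pdivlMr// hN.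
- exact: (continuous_cvg _ (@inner_ctsr _ _ v l) ul).
Qed.

End Riesz.

(** * Adjoints and the operator norm *)

Section Adjoint.
Variables (R : realType) (H : hilbertType R).
Local Notation C := R[i].
Implicit Types A B : H -> H.

Lemma is_adjoint_uniq A B B' : is_adjoint A B -> is_adjoint A B' -> B = B'.
Proof.
by move=> AB AB'; apply/funext => y; apply: inner_extr => x; rewrite -AB AB'.
Qed.

Lemma is_adjoint_sym A B : is_adjoint A B -> is_adjoint B A.
Proof. by move=> AB x y; rewrite innerC -AB -innerC. Qed.

Lemma is_adjoint_linear A B : is_adjoint A B -> linear A.
Proof.
move=> AB a x y; apply: inner_ext => z.
by rewrite AB !(innerDl, innerZl) !AB.
Qed.

(** Since [|B y|^2 = '[A (B y), y]], any bound for [A] also bounds [B]. *)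
Lemma is_adjoint_bounded A B : is_adjoint A B -> bounded_op H A -> bounded_op H B.
Proof.
move=> AB /bounded_opP[lA [c c0 cA]]; apply/bounded_opP.
split; first exact: is_adjoint_linear (is_adjoint_sym AB).
exists c => // y; have [->|By0] := eqVneq (B y) 0.
  by rewrite normr0 mulr_ge0// ler0c.
rewrite -(ler_pM2r (x := `|B y|)) ?normr_gt0// -expr2 -inner_norm -AB.
rewrite -(ger0_norm (x := '[A (B y), y])); last by rewrite AB inner_ge0.
by rewrite (le_trans (inner_cauchy_schwarz _ _))// mulrAC ler_wpM2r.
Qed.

(** [riesz] applied to [x |-> '[A x, y]] for each [y] produces an adjoint, so the default of [xget]
    is not reached. *)
Lemma adj_spec A : bounded_op H A -> is_adjoint A (adj A).
Proof.
move=> /bounded_opP[lA [c c0 cA]]; rewrite /adj.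
apply: (@xgetPex _ (fun=> 0) [set B | is_adjoint A B]).
suff /choice[B AB] : forall y, exists z, forall x, '[A x, y] = '[x, z].
  by exists B => x y.
move=> y; apply: (@riesz _ _ _ (c * complex.Re `|y|)).
  by move=> a u v; rewrite lA innerDl innerZl.
move=> x; rewrite (le_trans (inner_cauchy_schwarz _ _))// rmorphM/= RRe_real//.
by rewrite mulrAC ler_wpM2r.
Qed.

Lemma adjE A B : is_adjoint A B -> adj A = B.
Proof.
move=> AB; apply/esym/(is_adjoint_uniq AB).
exact: (@xgetPex _ (fun=> 0) [set B | is_adjoint A B] (ex_intro _ B AB)).
Qed.

Lemma selfadjointP A : bounded_op H A ->
  selfadjoint H A <-> forall x y, '[A x, y] = '[x, A y].
Proof.
move=> bA; split=> [sA|]; last exact: adjE.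
by have := adj_spec bA; rewrite sA.
Qed.

Lemma opnorm_bound A : bounded_op H A -> forall x, `|A x| <= (opnorm A)%:C * `|x|.
Proof.
move=> /bounded_opP[lA [c c0 cA]] x; have [->|x0] := eqVneq x 0.
  by rewrite (lin0 lA) !normr0 mulr0.
have xR : `|x|^-1 \is Num.real by rewrite rpredV normr_real.
rewrite mulrC -ler_pdivrMl ?normr_gt0//.
have -> : `|x|^-1 * `|A x| = `|A (`|x|^-1 *: x)|.
  by rewrite (linZ lA) normrZ normfV normr_id.
rewrite -(RRe_real (normr_real (A _))) lecR; apply: ub_le_sup; last first.
  by exists (`|x|^-1 *: x) => //=; rewrite normrZ normfV normr_id mulVf ?normr_eq0.
exists c => _ [y /= y1 <-]; rewrite -lecR RRe_real ?normr_real//.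
by rewrite (le_trans (cA y))// -[leRHS]mulr1 ler_wpM2l// ler0c.
Qed.

Lemma opnorm_le A (c : R) :
  (forall x, `|A x| <= c%:C * `|x|) -> 0 <= c -> opnorm A <= c.
Proof.
move=> cA c0; apply: ge_sup.
  by exists (complex.Re `|A 0|), 0 => //=; rewrite normr0.
move=> _ [y /= y1 <-]; rewrite -lecR RRe_real ?normr_real//.
by rewrite (le_trans (cA y))// -[leRHS]mulr1 ler_wpM2l// ler0c.
Qed.

Lemma opnorm_ge0 A : bounded_op H A -> 0 <= opnorm A.
Proof.
move=> /bounded_opP[lA [c c0 cA]]; apply: ub_le_sup; last first.
  by exists 0; rewrite /= ?normr0// (lin0 lA) normr0.
exists c => _ [y /= y1 <-]; rewrite -lecR RRe_real ?normr_real//.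
by rewrite (le_trans (cA y))// -[leRHS]mulr1 ler_wpM2l// ler0c.
Qed.

End Adjoint.

Local Notation proj := (@Defs.proj _ _).

(** * Orthogonal projection and compression *)

Section Projection.
Variables (R : realType) (H : hilbertType R) (M : closedSubspace H).
Local Notation C := R[i].
Implicit Types (x y : H) (A B : H -> H).

Lemma subhilbertP (k : subhilbert M) : cs_set M (val k).
Proof. exact: set_mem (valP k). Qed.

Lemma val_linear : linear (val : subhilbert M -> H).
Proof. by move=> a k l; exact: linearP. Qed.

(** The projection of [x] is the vector representing [k |-> '[val k, x]] in the Hilbert space
    [subhilbert M]. *)
Lemma proj_spec x (k : subhilbert M) : '[val (proj M x), val k] = '[x, val k].
Proof.
have [p xp] : exists p : subhilbert M, forall k : subhilbert M,
    '[x, val k] = '[val p, val k].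
  pose f (k : subhilbert M) := '[val k, x].
  have lf : scalar f.
    by move=> a u v; rewrite /f val_linear innerDl innerZl.
  have bf u : `|f u| <= (complex.Re `|x|)%:C * `|u|.
    by rewrite RRe_real ?normr_real// mulrC inner_cauchy_schwarz.
  have [p xp] := riesz lf bf.
  by exists p => u; rewrite innerC [X in X^*%R]xp -innerC.
apply/esym/subr0_eq; rewrite -innerBl.
apply: (@xgetPex _ 0 [set q : subhilbert M |
  forall k : subhilbert M, '[x - val q, val k] = 0]).
by exists p => u /=; rewrite innerBl xp subrr.
Qed.

Lemma proj_uniq x (p : subhilbert M) :
  (forall k : subhilbert M, '[val p, val k] = '[x, val k]) -> proj M x = p.
Proof.
move=> px; apply: inner_ext => k.
by rewrite -[LHS]/('[val _, val k]) proj_spec -px.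
Qed.

Lemma proj_val (k : subhilbert M) : proj M (val k) = k.
Proof. exact: proj_uniq. Qed.

Lemma val_proj x : cs_set M x -> val (proj M x) = x.
Proof.
move=> Mx.
by rewrite -[in LHS](_ : val (Subhilbert (mem_set Mx)) = x)// proj_val.
Qed.

Lemma proj_linear : linear (proj M).
Proof.
move=> a x y; apply: inner_ext => k; rewrite innerDl innerZl.
have projE z : '[proj M z, k] = '[z, val k] by exact: proj_spec.
by rewrite !projE innerDl innerZl.
Qed.

Lemma norm_proj x : `|proj M x| <= `|x|.
Proof.
have [->|p0] := eqVneq (proj M x) 0; first by rewrite normr0.
rewrite -(ler_pM2r (x := `|proj M x|)) ?normr_gt0// -expr2 -inner_norm.
have -> : '[proj M x, proj M x] = '[x, val (proj M x)] by exact: proj_spec.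
rewrite -(ger0_norm (x := '[x, _])); first exact: inner_cauchy_schwarz.
by rewrite -proj_spec inner_ge0.
Qed.

Lemma compressE A (k l : subhilbert M) : '[compress M A k, l] = '[A (val k), val l].
Proof. exact: proj_spec. Qed.

Lemma compress_bounded A : bounded_op H A -> bounded_op (subhilbert M) (compress M A).
Proof.
move=> /bounded_opP[lA [c c0 cA]]; apply/bounded_opP; split.
  move=> a k l; rewrite /compress.
  by rewrite val_linear lA proj_linear.
by exists c => // k; rewrite (le_trans (norm_proj _)).
Qed.

Lemma compress_selfadjoint A : bounded_op H A -> selfadjoint H A ->
  selfadjoint (subhilbert M) (compress M A).
Proof.
move=> bA /(selfadjointP bA) sA; apply/selfadjointP; first exact: compress_bounded.
by move=> k l; rewrite compressE sA [RHS]innerC compressE -innerC.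
Qed.

End Projection.

Lemma dense_sub (T : topologicalType) (D F : set T) :
  closure D = setT -> closed F -> D `<=` F -> forall x, F x.
Proof.
move=> D1 cF DF x; have : closure D x by rewrite D1.
by move=> /(closure_subset DF); rewrite -(closure_id _).1.
Qed.

(** * Square roots and positive functionals in a C*-algebra *)

Section CstarAlgebra.
Variables (R : realType) (A : cstarType R).
Local Notation C := R[i].
Implicit Types x y z : A.

Lemma norm_star x : `|star x| = `|x|.
Proof.
have le y : `|y| <= `|star y|.
  have [->|y0] := eqVneq y 0; first by rewrite normr0.
  by rewrite -(ler_pM2r (x := `|y|)) ?normr_gt0// -expr2 -cstar_norm cmul_norm.
by apply/eqP; rewrite eq_le le andbT -[leRHS]/(`|x|) -{2}[x]starK le.
Qed.

Lemma starB x y : star (x - y) = star x - star y.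
Proof. by rewrite -scaleN1r starD starZ rmorphN rmorph1 scaleN1r. Qed.

Lemma star_cts : continuous (@star R A).
Proof.
by apply: (@lipschitz_cts _ _ _ 1) => x y; rewrite -starB norm_star mul1r.
Qed.

Lemma star1 : star cone = cone :> A.
Proof. by rewrite -[star cone]cmul1l -[X in cmul X _]starK -starM cmul1l starK. Qed.

Lemma cmulBl x y z : cmul (x - y) z = cmul x z - cmul y z.
Proof. exact: (linB (cmul_linearl z)). Qed.

Lemma cmulBr x y z : cmul z (x - y) = cmul z x - cmul z y.
Proof. exact: (linB (cmul_linearr z)). Qed.

(* With y = 1 - z the equation z^2 = 1 - x becomes the fixed-point equation
   y = (x + y^2) / 2, a contraction of the ball of radius 1/2. *)
Lemma cstar_sqrt x : star x = x -> `|x| <= 2^-1 ->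
  exists z, star z = z /\ cmul z z = cone - x.
Proof.
move=> sx x2; pose F y := 2^-1 *: (x + cmul y y).
have half0 : 0 <= 2^-1 :> C by rewrite invr_ge0.
have halfR : (2^-1)^*%R = 2^-1 :> C by apply/CrealP; rewrite ger0_real.
have F_ball y : `|y| <= 2^-1 -> `|F y| <= 2^-1.
  move=> y2; rewrite normrZ ger0_norm// -[leRHS]mulr1 ler_wpM2l//.
  rewrite (le_trans (ler_normD _ _))// (le_trans (lerD x2 (cmul_norm _ _)))//.
  rewrite (le_trans (lerD (lexx _) (ler_pM (normr_ge0 _) (normr_ge0 _) y2 y2)))//.
  rewrite [leRHS](splitr 1) mul1r lerD2l -[leRHS]mulr1 ler_wpM2l//.
  by rewrite invf_le1 ?ler1n.
have F_star y : star y = y -> star (F y) = F y.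
  by move=> sy; rewrite starZ starD starM sx sy [X in X *: _]halfR.
have F_contr y z : `|y| <= 2^-1 -> `|z| <= 2^-1 ->
    `|F y - F z| <= 2^-1 * `|y - z|.
  move=> y2 z2; rewrite -scalerBr normrZ ger0_norm// ler_wpM2l//.
  rewrite opprD addrACA subrr add0r.
  have -> : cmul y y - cmul z z = cmul y (y - z) + cmul (y - z) z.
    by rewrite cmulBr cmulBl addrA subrK.
  rewrite (le_trans (ler_normD _ _))//.
  (* Half of [|y| + |z|] is at most 1/2 on the ball, which is the contraction factor. *)
  rewrite (le_trans (lerD (cmul_norm _ _) (cmul_norm _ _)))//.
  rewrite [X in X + _]mulrC -mulrDr -[leRHS]mulr1 ler_wpM2l//.
  by rewrite (splitr 1) mul1r lerD.
pose u n := iter n F 0.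
have u_ball n : `|u n| <= 2^-1.
  by elim: n => [|n ih]; [rewrite normr0|exact: F_ball].
have u_star n : star (u n) = u n.
  elim: n => [|n ih]; last exact: F_star.
  by have := starB (0 : A) 0; rewrite !subrr.
(* Both iterates come from [N] applications of [F] to points of the ball; these are at distance at
   most 1, and each application at least halves the distance. *)
have u_cauchy N m n : `|u (N + m)%N - u (N + n)%N| <= 2^-1 ^+ N.
  elim: N => [|N ih].
    by rewrite expr0 (le_trans (ler_normB _ _))// (splitr 1) mul1r lerD.
  by rewrite !addSn (le_trans (F_contr _ _ _ _))// exprS ler_wpM2l.
have [l ul] : exists l : A, u @ \oo --> l.
  apply: cauchy_seq_cvg => e /ltr_inv_nat[N hN]; exists N => m n Nm Nn.
  rewrite -(subnKC Nm) -(subnKC Nn) (le_lt_trans (u_cauchy _ _ _))//.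
  apply: le_lt_trans (hN N _) => //; rewrite exprVn lef_pV2 ?posrE ?exprn_gt0//.
  by rewrite -natrX ler_nat ltn_expl.
have norm_cts : continuous (fun y : A => `|y| : C^o).
  by apply: (@lipschitz_cts _ _ C^o 1) => y z; rewrite mul1r ler_dist_dist.
have l_ball : `|l| <= 2^-1.
  have cl : closed [set y : A | (`|y| : C^o) <= 2^-1].
    have c2 : continuous (fun _ : A => 2^-1 : C^o) by move=> y; exact: cvg_cst.
    exact: (closed_ler norm_cts c2).
  by apply: (closed_cvg _ cl _ _ ul); exact: nearW.
have l_star : star l = l.
  have cl : closed [set y : A | star y = y].
    have cid : continuous (fun y : A => y) by move=> y; exact: cvg_id.
    exact: (@closed_eq R A A _ _ star_cts cid).
  by apply: (closed_cvg _ cl _ _ ul); exact: nearW.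
have Fl : F l = l.
  apply: (@cvg_unique A _ ((fun n => u n.+1) @ \oo)).
  - exact: norm_hausdorff.
  - apply/cvgrPdist_lt => e e0; move/cvgrPdist_lt: ul => /(_ e e0)[N _ hN].
    exists N => // n /= Nn; apply: le_lt_trans (hN n Nn).
    apply: le_trans (F_contr _ _ l_ball (u_ball n)) _.
    by rewrite ler_piMl// invf_le1 ?ler1n.
  - by move: ul; rewrite -cvg_shiftS.
exists (cone - l); split; first by rewrite starB star1 l_star.
rewrite cmulBl !cmulBr !cmul1l cmul1r.
have ll : cmul l l = l *+ 2 - x.
  by rewrite -[in RHS]Fl /F -scaler_nat scalerA divff// scale1r addrAC subrr add0r.
by rewrite ll mulr2n opprB addrA -(addrA l l) addrA subrK addrAC addrA subrK.
Qed.

(* The constant 2 is not optimal; it avoids square roots of 1 - x for x of norm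
   close to 1. *)
Lemma positive_bounded (phi : A -> C) :
  scalar phi -> (forall x, 0 <= phi (cmul (star x) x)) ->
  forall x, star x = x -> phi x <= 2 * `|x| * phi cone.
Proof.
move=> lphi phi0.
have lp : linear (phi : A -> C^o) by [].
have small x : star x = x -> `|x| <= 2^-1 -> phi x <= phi cone.
  move=> sx x2; have [z [sz zz]] := cstar_sqrt sx x2.
  have := phi0 z; rewrite sz zz (linB lp) subr_ge0.
  exact.
move=> x sx; have [->|x0] := eqVneq x 0.
  by rewrite (lin0 lp) normr0 mulr0 mul0r.
have c0 : 0 < 2 * `|x| by rewrite mulr_gt0// normr_gt0.
have cR : ((2 * `|x|)^-1)^*%R = (2 * `|x|)^-1.
  by apply/CrealP; rewrite ger0_real// invr_ge0 ltW.
rewrite mulrC -ler_pdivrMr// mulrC.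
(* Division by [2 * |x|] brings [x] to norm exactly 1/2. *)
rewrite -[_ * phi x]/(_ *: (phi x : C^o)) -(linZ lp); apply: small.
- by rewrite starZ sx; congr (_ *: _).
- by rewrite normrZ normfV (ger0_norm (ltW c0)) invfM -mulrA mulVf ?normr_eq0 ?mulr1.
Qed.

(** * Continuity of representations *)

Section Representation.
Variables (H : hilbertType R) (pi : A -> H -> H).
Hypothesis rpi : representation pi.

(** The functional [y |-> '[pi y h, h]] is positive, and [positive_bounded] at [cmul (star x) x]
    gives [2 |x|^2 |h|^2] as a bound for [|pi x h|^2]. The constant is rounded up to avoid a square
    root. *)
Lemma representation_bounded x h : `|pi x h| <= 2 * `|h| * `|x|.
Proof.
have [_ lpi pi1 piM piS] := rpi.
have lphi : scalar (fun y => '[pi y h, h]).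
  by move=> a y z /=; rewrite lpi innerDl innerZl.
have phiE y : '[pi (cmul (star y) y) h, h] = `|pi y h| ^+ 2.
  by rewrite piM/= piS starK inner_norm.
have h0 y : 0 <= '[pi (cmul (star y) y) h, h] by rewrite phiE exprn_ge0.
have := positive_bounded lphi h0 (x := cmul (star x) x).
rewrite starM starK phiE pi1 cstar_norm inner_norm => /(_ erefl) le2.
rewrite -(ler_pXn2r (n := 2)) ?nnegrE ?mulr_ge0//.
apply: le_trans le2 _.
have -> : (2 * `|h| * `|x|) ^+ 2 = 2 * `|x| ^+ 2 * `|h| ^+ 2 * 2 :> C by ring.
by rewrite ler_peMr ?mulr_ge0 ?exprn_ge0 ?ler1n.
Qed.

Lemma representation_cts h : continuous (fun x => pi x h).
Proof.
have [_ lpi _ _ _] := rpi.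
apply: (@lipschitz_cts _ _ _ (2 * `|h|)) => x y.
have -> : pi x h - pi y h = pi (x - y) h by rewrite (linB lpi).
exact: representation_bounded.
Qed.

End Representation.

End CstarAlgebra.

(** * Induction over the Cuntz generators *)

Section Generation.
Variables (R : realType) (d : nat) (A : cstarType R) (s : 'I_d -> A).
Hypothesis sA : cuntz_algebra s.

(** Generation is applied to the set of [y] with both [y] and [star y] in [P], which is closed under
    [star] even when [P] is not. *)
Lemma cuntz_ind (P : set A) : closed P -> P cone ->
  (forall (a : R[i]) x y, P x -> P y -> P (a *: x + y)) ->
  (forall x y, P x -> P y -> P (cmul x y)) ->
  (forall i, P (s i) /\ P (star (s i))) -> forall x, P x.
Proof.
move=> cP P1 PZ PM Ps x.
have [_ sgen _] := sA.
have: [set y | P y /\ P (star y)] x; last by case.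
rewrite (sgen [set y | P y /\ P (star y)])//=; split.
- by rewrite /= star1.
- by move=> a y z [Py Psy] [Pz Psz]; split; [exact: PZ|rewrite starD starZ; exact: PZ].
- by move=> y z [Py Psy] [Pz Psz]; split; [exact: PM|rewrite starM; exact: PM].
- by move=> y [Py Psy]; split=> //; rewrite starK.
- apply: closedI => //; apply: closed_comp cP => y _; exact: star_cts.
Qed.

End Generation.

(** * The increasing tower of subspaces over [M] *)

Section CuntzFamily.
Variables (R : realType) (H : hilbertType R) (d : nat).
Variables (S T : 'I_d -> H -> H) (M : closedSubspace H).
Local Notation C := R[i].
Hypothesis adjST : forall i, is_adjoint (S i) (T i).
Hypothesis TSE : forall i j x, T i (S j x) = if i == j then x else 0.
Hypothesis sumST : forall x, \sum_(i < d) S i (T i x) = x.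
Hypothesis TM : forall i x, cs_set M x -> cs_set M (T i x).

Let linS i : linear (S i). Proof. exact: is_adjoint_linear (adjST i). Qed.
Let linT i : linear (T i).
Proof. exact: is_adjoint_linear (is_adjoint_sym (adjST i)). Qed.

(** The family [T] embeds [H] isometrically into [d] copies of itself. Every induction along the
    tower uses this splitting. *)
Lemma inner_cuntz x y : '[x, y] = \sum_(i < d) '[T i x, T i y].
Proof.
rewrite -[in LHS](sumST x) inner_suml; apply: eq_bigr => i _; exact: adjST.
Qed.

(* The vectors x all of whose S_I^* x with |I| = n lie in M, that is, the
   closed span of the S_I M with |I| = n. *)
Fixpoint tower n : set H :=
  if n is m.+1 then [set x | forall i, tower m (T i x)] else cs_set M.

Definition towers : set H := \bigcup_n tower n.

Lemma towerS n : tower n `<=` tower n.+1.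
Proof.
elim: n => [|n ih] x; first by move=> Mx i; exact: TM.
by move=> nx i; apply: ih; exact: nx.
Qed.

Lemma tower_leq m n : (m <= n)%N -> tower m `<=` tower n.
Proof.
by move=> /subnK <-; elim: (n - m)%N => // p ih x /ih; exact: towerS.
Qed.

Lemma towerP n a x y : tower n x -> tower n y -> tower n (a *: x + y).
Proof.
elim: n x y => [|n ih] x y; first exact: csP.
by move=> xn yn i; rewrite linT; exact: ih.
Qed.

Lemma tower_S i n x : tower n x -> tower n.+1 (S i x).
Proof.
move=> nx j /=; rewrite TSE; case: ifP => // _.
(* For [i != j] the vector is 0, which lies in the tower as [- x + x]. *)
have := towerP (-1) nx nx; rewrite scaleN1r addNr; exact.
Qed.

Lemma towers_T i x : towers x -> towers (T i x).
Proof. by move=> [n _ /towerS nx]; exists n => //; exact: nx. Qed.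

Lemma towers_S i x : towers x -> towers (S i x).
Proof. by move=> [n _ nx]; exists n.+1 => //; exact: tower_S. Qed.

Lemma towersP a x y : towers x -> towers y -> towers (a *: x + y).
Proof.
move=> [m _ mx] [n _ ny]; exists (maxn m n) => //; apply: towerP.
- exact: tower_leq (leq_maxl _ _) _ mx.
- exact: tower_leq (leq_maxr _ _) _ ny.
Qed.

(** The levels increase, so finitely many vectors share a level. Hence the closed span of the union
    is just its closure. *)
Lemma lspan_towers : lspan towers `<=` towers.
Proof.
have t0 : towers 0 by exists 0%N => //; exact: cs0.
move=> _ [n [a [v [tv ->]]]]; elim: n a v tv => [|n ih] a v tv.
  by rewrite big_ord0.
by rewrite big_ord_recl; apply: towersP => //; exact: ih.
Qed.

(** * Positivity and bounds for operators commuting with the [T i] *)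

Section Commuting.
Variable A : H -> H.
Hypothesis AT : forall i x, A (T i x) = T i (A x).

Lemma inner_comm x y : '[A x, y] = \sum_(i < d) '[A (T i x), T i y].
Proof. by rewrite inner_cuntz; apply: eq_bigr => i _; rewrite AT. Qed.

Lemma tower_ge0 n x : (forall k, cs_set M k -> 0 <= '[A k, k]) ->
  tower n x -> 0 <= '[A x, x].
Proof.
move=> A0; elim: n x => [|n ih] x; first exact: A0.
by move=> nx; rewrite inner_comm; apply: sumr_ge0 => i _; exact: ih.
Qed.

(** The bound is a sum of squared norms rather than a product of norms, so that it adds up over [i]
    exactly by [inner_cuntz]. *)
Lemma tower_bound n (c : C) x y :
  (forall k l, cs_set M k -> cs_set M l ->
    `|'[A k, l]| <= c * ('[k, k] + '[l, l])) ->
  tower n x -> tower n y -> `|'[A x, y]| <= c * ('[x, x] + '[y, y]).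
Proof.
move=> Ac; elim: n x y => [|n ih] x y; first exact: Ac.
move=> nx ny; rewrite inner_comm (inner_cuntz x x) (inner_cuntz y y).
rewrite -big_split mulr_sumr (le_trans (ler_norm_sum _ _ _))//.
by apply: ler_sum => i _; exact: ih.
Qed.

Hypothesis towers_dense : closure towers = setT.
Hypothesis bA : bounded_op H A.

Lemma comm_ge0 : op_ge0 (compress M A) <-> op_ge0 A.
Proof.
split=> [A0|A0 k]; last by rewrite compressE; exact: A0.
apply: (dense_sub towers_dense).
  apply: (@closed_ler _ _ (fun=> 0)); first by move=> x; exact: cvg_cst.
  move=> x; apply: inner_cvg; [exact: (bA.2 x)|exact: cvg_id].
move=> x [n _]; apply: tower_ge0 => k Mk.
by have := A0 (Subhilbert (mem_set Mk)); rewrite compressE.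
Qed.

Lemma comm_bound (c : C) : 0 <= c ->
  (forall k : subhilbert M, `|compress M A k| <= c * `|k|) ->
  forall x, `|A x| <= c * `|x|.
Proof.
move=> c0 cA.
(* Turns the product bound on [M] into the additive form required by [tower_bound]. *)
have AGM (p q : C) : 0 <= p -> 0 <= q -> p * q <= 2^-1 * (p ^+ 2 + q ^+ 2).
  move=> p0 q0; rewrite -subr_ge0.
  have -> : 2^-1 * (p ^+ 2 + q ^+ 2) - p * q = 2^-1 * (p - q) ^+ 2 by field.
  rewrite mulr_ge0 ?invr_ge0// real_exprn_even_ge0// rpredB// ger0_real//.
have MA k l : cs_set M k -> cs_set M l ->
    `|'[A k, l]| <= (c / 2) * ('[k, k] + '[l, l]).
  move=> Mk Ml; pose k' := Subhilbert (mem_set Mk); pose l' := Subhilbert (mem_set Ml).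
  have -> : '[A k, l] = '[compress M A k', l'] by rewrite compressE.
  rewrite (le_trans (inner_cauchy_schwarz _ _))//.
  rewrite (le_trans (ler_wpM2r (normr_ge0 _) (cA k')))// -!mulrA ler_wpM2l//.
  by rewrite !inner_norm AGM.
have DA x y : towers x -> towers y ->
    `|'[A x, y]| <= (c / 2) * ('[x, x] + '[y, y]).
  move=> [m _ mx] [n _ ny]; apply: (tower_bound (n := maxn m n)) => //.
  - exact: tower_leq (leq_maxl _ _) _ mx.
  - exact: tower_leq (leq_maxr _ _) _ ny.
have affine r : continuous (fun z : C^o => (c / 2) * (z + r) : C^o).
  apply: (@lipschitz_cts _ C^o C^o `|c / 2|) => z w.
  by rewrite -mulrBr opprD addrACA subrr addr0 normrM.
have ncts : continuous (fun z : C^o => `|z| : C^o).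
  by apply: (@lipschitz_cts _ C^o C^o 1) => z w; rewrite mul1r ler_dist_dist.
have sq x : (fun y : H => '[y, y] : C^o) @ x --> ('[x, x] : C^o).
  by apply: inner_cvg; exact: cvg_id.
(* Density is used in one variable at a time, first for [x] and then for [y]. *)
have HA x y : `|'[A x, y]| <= (c / 2) * ('[x, x] + '[y, y]).
  move: x; apply: (dense_sub towers_dense).
    apply: closed_ler => x.
      apply: (continuous_cvg _ (ncts _)); apply: inner_cvg; last exact: cvg_cst.
      exact: bA.2.
    exact: (continuous_cvg _ (affine '[y, y] '[x, x]) (sq x)).
  move=> x Dx; move: y; apply: (dense_sub towers_dense).
    apply: closed_ler => y.
      by apply: (continuous_cvg _ (ncts _)); apply: inner_ctsr.
    under eq_fun => z do rewrite addrC.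
    exact: (continuous_cvg _ (affine '[x, x] '[y, y]) (sq y)).
  by move=> y Dy; exact: DA.
have lA := bA.1; move=> x.
have [->|x0] := eqVneq x 0; first by rewrite (lin0 lA) !normr0 mulr0.
have [->|Ax0] := eqVneq (A x) 0; first by rewrite normr0 mulr_ge0.
(* On the unit vectors along [x] and [A x] the left side is [|A x| / |x|] and the right side is
   [c]. *)
have := HA (`|x|^-1 *: x) (`|A x|^-1 *: A x).
have nv (y : H) : y != 0 -> '[`|y|^-1 *: y, `|y|^-1 *: y] = 1.
  by move=> y0; rewrite inner_norm normrZ normfV normr_id mulVf ?normr_eq0 ?expr1n.
rewrite !nv// (linZ lA) innerZl innerZr inner_norm !normrM !normr_id.
rewrite norm_conjC !normfV !normr_id mulKf ?normr_eq0//.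
by rewrite -mulrA (_ : 2^-1 * (1 + 1) = 1) ?mulr1 ?mulVf// ler_pdivrMl ?normr_gt0// mulrC.
Qed.

End Commuting.

End CuntzFamily.

(** * Extension of a fixed point to an operator on [H] *)

Section Extension.
Variables (R : realType) (H : hilbertType R) (d : nat).
Variables (S T : 'I_d -> H -> H) (M : closedSubspace H).
Local Notation C := R[i].
Hypothesis adjST : forall i, is_adjoint (S i) (T i).
Hypothesis TSE : forall i j x, T i (S j x) = if i == j then x else 0.
Hypothesis sumST : forall x, \sum_(i < d) S i (T i x) = x.
Hypothesis TM : forall i x, cs_set M x -> cs_set M (T i x).
Hypothesis bS : forall i, bounded_op H (S i).
Hypothesis towers_dense : closure (towers T M) = setT.

Let linS i : linear (S i). Proof. exact: is_adjoint_linear (adjST i). Qed.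
Let linT i : linear (T i).
Proof. exact: is_adjoint_linear (is_adjoint_sym (adjST i)). Qed.
Let bT i : bounded_op H (T i).
Proof. exact: is_adjoint_bounded (adjST i) (bS i). Qed.

Variable B : subhilbert M -> subhilbert M.
Hypothesis bB : bounded_op (subhilbert M) B.

(* For n = 0 this is B P, and in general sum_{|I| = n} S_I B P S_I^*. *)
Fixpoint ext n : H -> H :=
  if n is m.+1 then fun x => \sum_(i < d) S i (ext m (T i x))
  else fun x => val (B (Defs.proj M x)).

Lemma ext_linear n : linear (ext n).
Proof.
elim: n => [|n ih] a x y /=.
  by rewrite proj_linear bB.1; exact: val_linear.
rewrite scaler_sumr -big_split; apply: eq_bigr => i _.
by rewrite linT ih linS.
Qed.

(** Intertwining up to an index shift; the shift disappears in the limit and leaves commutation with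
    [T i]. [ext_S] does the same for [S i]. *)
Lemma T_ext n i x : T i (ext n.+1 x) = ext n (T i x).
Proof.
rewrite /= (lin_sum (linT i)) (bigD1 i)//= TSE eqxx big1 ?addr0// => j ji.
by rewrite TSE eq_sym (negbTE ji).
Qed.

Lemma ext_S n i x : ext n.+1 (S i x) = S i (ext n x).
Proof.
rewrite /= (bigD1 i)//= TSE eqxx big1 ?addr0// => j ji.
by rewrite TSE (negbTE ji) (lin0 (ext_linear n)) (lin0 (linS j)).
Qed.

(** A bound for [B] serves all [n]: by [inner_cuntz] and [T_ext] the squared norm of [ext n.+1 x] is
    the sum of those of [ext n (T i x)]. *)
Lemma ext_bound : exists2 c : R, 0 <= c & forall n x, `|ext n x| <= c%:C * `|x|.
Proof.
have [c c0 cB] := ((bounded_opP _).1 bB).2; exists c => // n x.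
rewrite -(ler_pXn2r (n := 2)) ?nnegrE ?mulr_ge0 ?ler0c//.
rewrite exprMn -!inner_norm; elim: n x => [|n ih] x.
  rewrite !inner_norm -exprMn ler_pXn2r ?nnegrE ?mulr_ge0 ?ler0c//.
  rewrite /= (le_trans (cB _))// ler_wpM2l ?ler0c//; exact: norm_proj.
rewrite (inner_cuntz adjST sumST) (inner_cuntz adjST sumST x) mulr_sumr.
by apply: ler_sum => i _; rewrite T_ext.
Qed.

Lemma tower_ext n x : tower T M n (ext n x).
Proof.
elim: n x => [|n ih] x; first exact: subhilbertP.
by move=> i; rewrite T_ext.
Qed.

Lemma ext_selfadjoint : selfadjoint (subhilbert M) B ->
  forall n x y, '[ext n x, y] = '[x, ext n y].
Proof.
move=> /(selfadjointP bB) sB; elim=> [|n ih] x y.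
  rewrite /= innerC -proj_spec -innerC.
  by rewrite [LHS](sB (Defs.proj M x) (Defs.proj M y)); exact: proj_spec.
rewrite !(inner_cuntz adjST sumST _ y) (inner_cuntz adjST sumST x).
by apply: eq_bigr => i _; rewrite !T_ext.
Qed.

(** Weak form of the fixed-point equation, with the compression of [T i] in the place of the adjoint
    of [V i]. *)
Hypothesis B_fixed : forall k l,
  '[B k, l] = \sum_(i < d) '[B (compress M (T i) k), compress M (T i) l].

Lemma ext_step n x y : tower T M n x -> tower T M n y ->
  '[ext n.+1 x, y] = '[ext n x, y].
Proof.
elim: n x y => [|n ih] x y nx ny.
  pose x' := Subhilbert (mem_set (nx : cs_set M x)).
  pose y' := Subhilbert (mem_set (ny : cs_set M y)).
  (* On [M] itself, [T_ext] reduces the claim to [B] evaluated at the vectors [T i x] and [T i y] of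
     [M], which is [B_fixed]. *)
  rewrite (inner_cuntz adjST sumST).
  transitivity '[B x', y']; last by rewrite -(proj_val x').
  rewrite B_fixed; apply: eq_bigr => i _; rewrite T_ext -[RHS]/('[val _, val _]).
  by rewrite val_proj//; exact: TM.
rewrite (inner_cuntz adjST sumST) [RHS](inner_cuntz adjST sumST).
by apply: eq_bigr => i _; rewrite !T_ext; apply: ih; [exact: nx|exact: ny].
Qed.

Lemma ext_stable m n x y : (m <= n)%N -> tower T M m x -> tower T M m y ->
  '[ext n x, y] = '[ext m x, y].
Proof.
move=> /subnK <- mx my; elim: (n - m)%N => // p <-.
by rewrite addSn; apply: ext_step; exact: (tower_leq TM (leq_addl p m)).
Qed.

(* On tower m the projection of ext n' x onto tower n is ext n x, so the norms
   increase and their increments control the distances. *)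
Lemma ext_pythagoras m n p x : tower T M m x -> (m <= n)%N -> (n <= p)%N ->
  '[ext p x - ext n x, ext p x - ext n x] =
  '[ext p x, ext p x] - '[ext n x, ext n x].
Proof.
move=> mx mn np; have nx := tower_leq TM mn mx.
have e : '[ext p x, ext n x] = '[ext n x, ext n x].
  exact: ext_stable np nx (tower_ext n x).
move: (ext p x) (ext n x) e => u v e.
by rewrite innerBl !innerBr e (innerC v u) e -innerC; ring.
Qed.

Lemma ext_cauchy_tower x e : towers T M x -> 0 < e ->
  exists N, forall p q, (N <= p)%N -> (N <= q)%N -> `|ext p x - ext q x| < e.
Proof.
move=> [m _ mx] e0; have [c c0 cE] := ext_bound.
(* Monotonicity is available only from the level [m] of [x] on, hence the shift. *)
pose v n := complex.Re '[ext (n + m) x, ext (n + m) x].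
have vE n : (v n)%:C = '[ext (n + m) x, ext (n + m) x].
  by rewrite RRe_real// ger0_real// inner_ge0.
have supv : has_sup (range v).
  split; first by exists (v 0%N), 0%N.
  exists ((c * complex.Re `|x|) ^+ 2) => _ [n _ <-].
  rewrite -lecR vE inner_norm rmorphXn rmorphM/= RRe_real ?normr_real//.
  by rewrite ler_pXn2r ?nnegrE ?mulr_ge0 ?ler0c.
have eR : (complex.Re (e ^+ 2))%:C = e ^+ 2 by rewrite RRe_real// gtr0_real// exprn_gt0.
have e1 : 0 < complex.Re (e ^+ 2) by rewrite -ltcR eR exprn_gt0.
(* Beyond [N] the squared norms lie within [e^2] of their supremum, so by [ext_pythagoras] the
   vectors lie within [e] of each other. *)
have [_ [N _ <-] vN] := sup_adherent e1 supv.
have main p q : (N <= p)%N -> (p <= q)%N -> `|ext (q + m) x - ext (p + m) x| < e.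
  move=> Np pq; rewrite -(ltr_pXn2r (n := 2)) ?nnegrE ?(ltW e0)//.
  rewrite -inner_norm (ext_pythagoras mx) ?leq_addl ?leq_add2r//.
  have mono a b : (a <= b)%N -> v a <= v b.
    move=> ab; rewrite -lecR !vE -subr_ge0.
    by rewrite -(ext_pythagoras mx) ?leq_addl ?leq_add2r// inner_ge0.
  rewrite -!vE -eR -rmorphB ltcR.
  have vq : v q <= sup (range v) by apply: ub_le_sup; [case: supv|exists q].
  have := mono _ _ Np; rewrite ltrBlDr => vp.
  by rewrite (le_lt_trans vq)// -ltrBlDl (lt_le_trans vN).
exists (N + m)%N => p q Np Nq.
have wlog_main a b : (N + m <= a)%N -> (a <= b)%N -> `|ext b x - ext a x| < e.
  move=> Na ab; have ma : (m <= a)%N by rewrite (leq_trans _ Na)// leq_addl.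
  rewrite -(subnK ma) -(subnK (leq_trans ma ab)); apply: main.
    by rewrite leq_subRL// addnC.
  exact: leq_sub2r.
case: (leqP p q) => [pq|/ltnW qp]; last exact: wlog_main.
by rewrite distrC; exact: wlog_main.
Qed.

(** The uniform bound carries the Cauchy property from the dense union to [H] by splitting [e] in
    three. *)
Lemma ext_cauchy x e : 0 < e ->
  exists N, forall p q, (N <= p)%N -> (N <= q)%N -> `|ext p x - ext q x| < e.
Proof.
move=> e0; have [c c0 cE] := ext_bound.
have e3 : 0 < e / 3%:R by rewrite divr_gt0.
have c1 : 0 < c%:C + 1 :> C by rewrite ltr_wpDl ?ler0c.
have r0 : 0 < e / 3%:R / (c%:C + 1) by rewrite divr_gt0.
have : closure (towers T M) x by rewrite towers_dense.
move=> /(_ (ball x (e / 3%:R / (c%:C + 1))) (nbhsx_ballx _ _ r0))[y [Ty]].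
rewrite -ball_normE /= => xy.
have [N hN] := ext_cauchy_tower Ty e3; exists N => p q Np Nq.
have near_xy n : `|ext n x - ext n y| <= e / 3%:R.
  rewrite -(linB (ext_linear n)) (le_trans (cE _ _))//.
  move: xy; rewrite ltr_pdivlMr// => /ltW; apply: le_trans.
  by rewrite mulrC ler_wpM2l// lerDl.
have -> : ext p x - ext q x =
    (ext p x - ext p y) + (ext p y - ext q y) + (ext q y - ext q x).
  by rewrite !addrA subrK subrK.
have -> : e = e / 3%:R + e / 3%:R + e / 3%:R by field.
rewrite (le_lt_trans (ler_normD _ _))// ltr_leD//; last by rewrite distrC.
by rewrite (le_lt_trans (ler_normD _ _))// ler_ltD// hN.
Qed.

Theorem extension : exists A : H -> H,
  [/\ bounded_op H A, forall i x, A (S i x) = S i (A x),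
      forall i x, A (T i x) = T i (A x), compress M A = B &
      selfadjoint (subhilbert M) B -> selfadjoint H A].
Proof.
have [A eA] : exists A : H -> H, forall x, (fun n => ext n x) @ \oo --> A x.
  have /choice[A eA] : forall x, exists l : H, (fun n => ext n x) @ \oo --> l.
    by move=> x; apply: cauchy_seq_cvg => e; exact: ext_cauchy.
  by exists A.
(* Absorbs the index shift in [T_ext] and [ext_S]. *)
have eAS x : (fun n => ext n.+1 x) @ \oo --> A x.
  by have := eA x; rewrite -cvg_shiftS.
have uniqH (u : nat -> H) (a b : H) : u @ \oo --> a -> u @ \oo --> b -> a = b.
  by move=> ua ub; apply: (cvg_unique _ ua ub); exact: norm_hausdorff.
have lA : linear A.
  move=> a x y; apply: (uniqH (fun n => ext n (a *: x + y))); first exact: eA.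
  under eq_fun => n do rewrite ext_linear.
  by apply: cvgD; [apply: cvgZl_tmp; exact: eA|exact: eA].
have bA : bounded_op H A.
  apply/bounded_opP; split=> //; have [c c0 cE] := ext_bound; exists c => // x.
  have ncts : continuous (fun y : H => `|y| : C^o).
    by apply: (@lipschitz_cts _ _ C^o 1) => y z; rewrite mul1r ler_dist_dist.
  have ccts : continuous (fun _ : H => c%:C * `|x| : C^o).
    by move=> y; exact: cvg_cst.
  have := closed_ler ncts ccts => cl.
  by apply: (closed_cvg _ cl _ _ (eA x)); apply: nearW => n /=.
exists A; split=> //.
- move=> i x; apply: (uniqH (fun n => ext n.+1 (S i x))); first exact: eAS.
  under eq_fun => n do rewrite ext_S.
  exact: (continuous_cvg _ ((bS i).2 (A x)) (eA x)).
- move=> i x; apply: (uniqH (fun n => ext n (T i x))); first exact: eA.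
  under eq_fun => n do rewrite -T_ext.
  exact: (continuous_cvg _ ((bT i).2 (A x)) (eAS x)).
- apply/funext => k; apply: inner_ext => l; rewrite compressE.
  apply: (@cvg_unique C^o _ ((fun n => '[ext n (val k), val l] : C^o) @ \oo)).
  + exact: (@norm_hausdorff _ C^o).
  + exact: (continuous_cvg _ (@inner_ctsl _ _ (val l) (A (val k))) (eA (val k))).
  (* Vectors of [M] have level 0, where the matrix coefficients are constant in [n]. *)
  + have -> : (fun n => '[ext n (val k), val l] : C^o) = (fun=> '[B k, l]).
      apply/funext => n; rewrite (@ext_stable 0 n)//; [|exact: subhilbertP..].
      by rewrite /= proj_val.
    exact: cvg_cst.
- move=> sB; apply/(selfadjointP bA) => x y.
  apply: (@cvg_unique C^o _ ((fun n => '[ext n x, y] : C^o) @ \oo)).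
  + exact: (@norm_hausdorff _ C^o).
  + exact: (continuous_cvg _ (@inner_ctsl _ _ y (A x)) (eA x)).
  + have -> : (fun n => '[ext n x, y] : C^o) = (fun n => '[x, ext n y] : C^o).
      by apply/funext => n; exact: ext_selfadjoint.
    exact: (continuous_cvg _ (@inner_ctsr _ _ x (A y)) (eA y)).
Qed.

End Extension.

(** * Closed spans and the weak form of Kraus maps *)

Section ClosedSpan.
Variables (R : realType) (H : hilbertType R).
Implicit Types (X : set H) (A B : H -> H).

Lemma sub_lspan X : X `<=` lspan X.
Proof.
move=> x Xx; exists 1%N, (fun=> 1), (fun=> x); split=> //.
by rewrite big_ord1 scale1r.
Qed.

Lemma sub_closed_span X : X `<=` cs_set (closed_span X).
Proof. by move=> x /sub_lspan/subset_closure. Qed.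

Lemma closed_span_stable X A : bounded_op H A -> (forall x, X x -> X (A x)) ->
  forall x, cs_set (closed_span X) x -> cs_set (closed_span X) (A x).
Proof.
move=> [lA cA] XA; have AX : lspan X `<=` A @^-1` closure (lspan X).
  move=> _ [n [a [v [Xv ->]]]]; rewrite /preimage/= (lin_sum lA).
  apply: subset_closure; exists n, a, (A \o v); split=> [k|]; first exact: XA.
  by apply: eq_bigr => k _; rewrite (linZ lA).
move=> x /(closure_subset AX); rewrite -(closure_id _).1//.
by apply: closed_comp => [y _|]; [exact: cA|exact: closed_closure].
Qed.

Lemma bounded_opB A B : bounded_op H A -> bounded_op H B ->
  bounded_op H (fun x => A x - B x).
Proof.
move=> [lA cA] [lB cB]; split=> [a x y|x].
  by rewrite lA lB scalerBr opprD addrACA.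
by apply: cvgB; [exact: cA|exact: cB].
Qed.

Lemma kraus_mapE (d : nat) (V : 'I_d -> H -> H) A x y :
  (forall i, bounded_op H (V i)) ->
  '[kraus_map V A x, y] = \sum_(i < d) '[A (adj (V i) x), adj (V i) y].
Proof.
move=> bV; rewrite /kraus_map fct_sumE inner_suml.
by apply: eq_bigr => i _; exact: (adj_spec (bV i)).
Qed.

End ClosedSpan.

(** * Commutants and density in representations of the Cuntz algebra *)

Section CuntzRepresentation.
Variables (R : realType) (d : nat) (Od : cstarType R) (s : 'I_d -> Od).
Variables (H : hilbertType R) (pi : Od -> H -> H).
Hypothesis cs : cuntz_algebra s.
Hypothesis rpi : representation pi.
Local Notation S := (fun i => pi (s i)).
Local Notation T := (fun i => pi (star (s i))).

Lemma cuntz_adjoint i : is_adjoint (S i) (T i).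
Proof. by have [_ _ _ _] := rpi; apply. Qed.

Lemma cuntz_orth i j x : T i (S j x) = if i == j then x else 0.
Proof.
have [_ lpi pi1 piM _] := rpi; have [[ss _] _ _] := cs.
rewrite -[LHS]/((T i \o S j) x) -piM ss; case: ifP => _; first by rewrite pi1.
by rewrite (lin0 lpi).
Qed.

Lemma cuntz_sum x : \sum_(i < d) S i (T i x) = x.
Proof.
have [_ lpi pi1 piM _] := rpi; have [[_ ss] _ _] := cs.
transitivity (pi cone x); last by rewrite pi1.
rewrite -ss (lin_sum lpi) fct_sumE; apply: eq_bigr => i _.
by rewrite piM.
Qed.

(** The elements whose image commutes with [A] form an algebra, closed because [y |-> pi y x] is
    continuous for each vector [x]. *)
Lemma cuntz_commutant A : bounded_op H A ->
  (forall i x, A (S i x) = S i (A x)) -> (forall i x, A (T i x) = T i (A x)) ->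
  commutant (range pi) A.
Proof.
move=> bA AS AT; have [bpi lpi pi1 piM _] := rpi.
split=> // _ [y _ <-]; apply/funext => x /=; move: y x.
pose P := \bigcap_(x in [set: H]) [set y | A (pi y x) = pi y (A x)].
suff PT y : P y by move=> y x; exact: PT.
apply: (cuntz_ind cs) => {y}.
- apply: closed_bigI => x _; apply: closed_eq; last exact: representation_cts.
  move=> y; apply: (continuous_cvg _ (bA.2 (pi y x))).
  exact: (representation_cts rpi).
- by move=> x _; rewrite /= pi1.
- move=> a y z Py Pz x _ /=.
  by rewrite !lpi !fctE bA.1 Py// Pz.
- by move=> y z Py Pz x _ /=; rewrite !piM /= Py// Pz.
- by move=> i; split=> x _; [exact: AS|exact: AT].
Qed.

Section Dense.
Variables (Omega : H) (M : closedSubspace H).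
Hypothesis cyclic : closure (range (fun x => pi x Omega)) = setT.
Hypothesis MOmega : cs_set M Omega.
Hypothesis TM : forall i x, cs_set M x -> cs_set M (T i x).

Lemma cuntz_towers_dense : closure (towers T M) = setT.
Proof.
have [bpi lpi pi1 piM _] := rpi.
pose N := closed_span (towers T M).
have NE : cs_set N = closure (towers T M).
  congr closure; apply/seteqP; split; last exact: sub_lspan.
  exact: (lspan_towers cuntz_adjoint TM).
(* All [h] in [N] are treated at once: for a product, [pi z h] becomes the next vector. *)
pose P := \bigcap_(h in cs_set N) [set y | cs_set N (pi y h)].
have PT y : P y.
  apply: (cuntz_ind cs) => {y}.
  - apply: closed_bigI => h _; apply: closed_comp (@cs_closed _ _ N) => y _.
    exact: representation_cts.
  - by move=> h Nh; rewrite /= pi1.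
  - move=> a y z Py Pz h Nh /=; rewrite lpi.
    exact: (@csP _ _ N a _ _ (Py h Nh) (Pz h Nh)).
  - by move=> y z Py Pz h Nh /=; rewrite piM; apply: Py; exact: Pz.
  - move=> i; split=> h; apply: closed_span_stable => // x.
      exact: (towers_S cuntz_adjoint cuntz_orth).
    exact: (towers_T TM).
have NOmega : cs_set N Omega by apply: sub_closed_span; exists 0%N.
apply/seteqP; split=> // x _; rewrite -NE.
apply: (dense_sub cyclic (@cs_closed _ _ N)) => _ [y _ <-].
exact: PT.
Qed.

End Dense.

End CuntzRepresentation.

(** * Compression as an isomorphism from the commutant onto the fixed points *)

Theorem proposition4p1 (R : realType) (d : nat) (hd : (2 <= d)%N)
    (Od : cstarType R) (s : 'I_d -> Od) (hOd : cuntz_algebra s)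
    (omega : Od -> R[i]) (homega : state omega)
    (H : hilbertType R) (Omega : H) (pi : Od -> H -> H)
    (hpi : gns_representation omega Omega pi) :
  let S i := pi (s i) in
  let K := closed_span (range (fun I : seq 'I_d => word_adj S I Omega)) in
  forall V : 'I_d -> subhilbert K -> subhilbert K,
    (forall i, bounded_op (subhilbert K) (V i)) ->
    (forall i, adj (V i) = compress K (adj (S i))) ->
    norm_order_iso
      (commutant (range pi) `&` selfadjoint H)
      (fixed_points (kraus_map V) `&` selfadjoint (subhilbert K))
      (compress K) /\
    (forall A : H -> H, commutant (range pi) A ->
      fixed_points (kraus_map V) (compress K A)).
Proof.
move=> S K V bV adjV; have [rpi cyc _] := hpi; have [bpi _ _ _ _] := rpi.
pose T i := pi (star (s i)).
have adjST : forall i, is_adjoint (S i) (T i) := cuntz_adjoint s rpi.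
have sumST : forall x, \sum_(i < d) S i (T i x) = x := cuntz_sum hOd rpi.
have TSE : forall i j x, T i (S j x) = if i == j then x else 0.
  exact: (cuntz_orth hOd rpi).
have adjS i : adj (S i) = T i by exact: adjE.
have TK i x : cs_set K x -> cs_set K (T i x).
  apply: closed_span_stable; first exact: bpi.
  (* Adjoints reverse words, so applying [T i] on the left appends [i] at the end. *)
  move=> _ [w _ <-]; exists (rcons w i) => //.
  by rewrite /word_adj rev_rcons /= adjS.
have KOmega : cs_set K Omega by apply: sub_closed_span; exists [::].
have dense := cuntz_towers_dense hOd rpi cyc KOmega TK.
have commT A : commutant (range pi) A -> forall i x, A (T i x) = T i (A x).
  move=> [_ cA] i x; have /cA e : range pi (T i) by exists (star (s i)).
  exact: (congr1 (fun f => f x) e).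
have krausE B k l : '[kraus_map V B k, l] =
    \sum_(i < d) '[B (compress K (T i) k), compress K (T i) l].
  by rewrite kraus_mapE//; apply: eq_bigr => i _; rewrite adjV adjS.
(* By invariance of [K] the compression of [T i] is a mere restriction. *)
have val_compress i k : val (compress K (T i) k) = T i (val k).
  by apply: val_proj; apply: TK; exact: subhilbertP.
have compress_fixed A : commutant (range pi) A ->
    fixed_points (kraus_map V) (compress K A).
  move=> cA; split; first exact/compress_bounded/cA.1.
  apply/funext => k; apply: inner_ext => l; rewrite krausE compressE.
  rewrite (inner_comm adjST sumST (commT A cA)); apply: eq_bigr => i _.
  by rewrite compressE !val_compress.
have bound A (AT : forall i x, A (T i x) = T i (A x)) :=
  comm_bound adjST sumST TK AT dense.
split=> //; split.
- split.
  + move=> A [cA sA]; split; first exact: compress_fixed.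
    exact: compress_selfadjoint cA.1 sA.
  + move=> A B /set_mem[cA sA] /set_mem[cB sB] AB; apply/funext => x.
    apply/subr0_eq/normr0_eq0/le_anti; rewrite normr_ge0 andbT -(mul0r `|x|).
    (* Injectivity is the norm bound with constant 0 for the difference. *)
    apply: (bound (fun x => A x - B x)) => //.
    * move=> i y; rewrite (commT _ cA) (commT _ cB).
      by rewrite (linB (is_adjoint_linear (is_adjoint_sym (adjST i)))).
    * exact: bounded_opB cA.1 cB.1.
    * move=> k; rewrite mul0r (_ : compress K _ k = 0) ?normr0//.
      apply: inner_ext => l; rewrite inner0l compressE innerBl.
      by rewrite -!compressE AB subrr.
  + move=> B [[bB fB] sB].
    have Bf k l : '[B k, l] =
        \sum_(i < d) '[B (compress K (T i) k), compress K (T i) l].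
      by rewrite -krausE fB.
    have bS i : bounded_op H (S i) by exact: bpi.
    have [A [bA AS AT AB sA]] := extension adjST TSE sumST TK bS dense bB Bf.
    exists A => //; split; last exact: sA.
    exact: (cuntz_commutant hOd rpi).
- move=> r A B _ _; apply/funext => k.
  by rewrite /compress !fctE proj_linear.
- move=> A [cA _]; have bA := cA.1; have bcA := compress_bounded K bA.
  (* One inequality holds because projecting is contractive, the other is [bound] with the norm of
     the compression as constant. *)
  apply/le_anti/andP; split; apply: opnorm_le; rewrite ?opnorm_ge0//.
    by move=> k; rewrite (le_trans (norm_proj _ _))// (opnorm_bound bA).
  apply: bound => //; first exact: commT; first by rewrite ler0c opnorm_ge0.
  exact: opnorm_bound.
- by move=> A [cA _]; apply: (comm_ge0 adjST sumST (commT A cA) dense cA.1).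
Qed.
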